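(* Let $(B,\cdot,\circ)$ be a left semi-brace. If $1_{\circ}B=\{1_{\circ}\cdot b\mid b\in B\}$ is a subgroup of $(B,\circ)$ (for example, if $B$ is finite), then $(B,\cdot)$ is a completely simple semigroup with maximal subgroup $1_{\circ}B1_{\circ}=\{1_{\circ}\cdot b\cdot 1_{\circ}\mid b\in B\}$.
   Context: A left semi-brace is a set $B$ with two operations $\cdot$ and $\circ$ such that $(B,\cdot)$ is a semigroup, $(B,\circ)$ is a group, and $a\circ(b\cdot c)=(a\circ b)\cdot(a\circ(\overline{a}\cdot c))$ for all $a,b,c\in B$, where $\overline{a}$ denotes the inverse of $a$ in $(B,\circ)$. The identity of $(B,\circ)$ is denoted $1_{\circ}$, and $a\cdot b$ is written $ab$. *)

(* Defs.v *)
From HB Require Import structures.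
From mathcomp Require Import all_boot.
From mathcomp Require Import boolp classical_sets functions cardinality.

Set Implicit Arguments.
Unset Strict Implicit.
Unset Printing Implicit Defensive.

Local Open Scope classical_set_scope.
Local Open Scope group_scope.

Declare Scope semibrace_scope.
Delimit Scope semibrace_scope with brace.

Reserved Notation "a ∘ b" (at level 40, left associativity).
Reserved Notation "a · b" (at level 40, left associativity).

Notation "a ∘ b" := (mul a b) : semibrace_scope.

(* The group law, identity and inverse inherited from groupType are those of
   (B, ∘); only the semigroup law is added. *)
HB.mixin Record isLeftSemiBrace B of Group B := {
  dot : B -> B -> B;
  dotA : associative dot;
  circ_dot : forall a b c : B,
    (a ∘ dot b c)%brace = dot (a ∘ b)%brace (a ∘ dot a^-1 c)%brace
}.

#[short(type="leftSemiBraceType")]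
HB.structure Definition LeftSemiBrace := {B of Group B & isLeftSemiBrace B}.

Notation "a · b" := (dot a b) : semibrace_scope.

(* Stated for an arbitrary law, since the multiplication attached to the carrier
   of a left semi-brace is ∘ and not the semigroup law. *)
Section SemigroupNotions.
Variables (S : Type) (op : S -> S -> S).

Definition idempotent_elt (e : S) : Prop := op e e = e.

(* e is minimal for the order  f <= e  iff  e f = f e = f  on idempotents. No
   clause excludes a zero: the notion is only used for semigroups without
   proper ideals, where a zero forces the semigroup to be trivial. *)
Definition primitive_idempotent (e : S) : Prop :=
  idempotent_elt e /\
  forall f, idempotent_elt f -> op e f = f -> op f e = f -> f = e.

Definition two_sided_ideal (I : set S) : Prop :=
  I !=set0 /\ forall x s, I x -> I (op s x) /\ I (op x s).

Definition simple_semigroup : Prop :=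
  associative op /\ forall I, two_sided_ideal I -> I = [set: S].

Definition completely_simple : Prop :=
  simple_semigroup /\ exists e, primitive_idempotent e.

(* The identity e of G need not be an identity of S. *)
Definition semigroup_subgroup (G : set S) : Prop :=
  (forall x y, G x -> G y -> G (op x y)) /\
  exists e, [/\ G e,
    forall x, G x -> op e x = x /\ op x e = x &
    forall x, G x -> exists y, [/\ G y, op x y = e & op y x = e]].

Definition maximal_subgroup (G : set S) : Prop :=
  semigroup_subgroup G /\
  forall H, semigroup_subgroup H -> G `<=` H -> H = G.

End SemigroupNotions.

(* Main.v *)
Require Import Defs.
From HB Require Import structures.
From mathcomp Require Import all_boot.
From mathcomp Require Import boolp classical_sets functions cardinality.

Set Implicit Arguments.
Unset Strict Implicit.

Local Open Scope classical_set_scope.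
Local Open Scope group_scope.
Local Open Scope semibrace_scope.

(** The axiom of a left semi-brace reads a ∘ (b · c) = (a ∘ b) · λ_a(c) with
    λ_a(c) = a ∘ (a^-1 · c). Since λ_1 is left multiplication by 1, the case
    a = 1 gives b · c = b · 1 · c: the element 1 is a middle unit of (B, ·)
    ([dot1_middle]). The case b = a^-1 shows that the values of every λ_a are
    fixed by left multiplication by 1 ([dot1_lambda]); it follows that 1 is
    idempotent ([dot11]), and then that every element is a product
    ([dot_factor]).

    On 1B the two laws are related by a ∘ b = a · λ_a(b), which shows that 1B is
    always closed under ∘ ([circ_left_translate]). A finite submonoid of a group
    is a subgroup, whence the example of finite B
    ([finite_submonoid_group_closed]). When 1B is a subgroup of (B, ∘), the
    element λ_a(a^-1) of 1B solves a · b = 1 for a in 1B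
    ([left_translate_rinv]): right inverses for · come from inverses for ∘.

    The rest is semigroup theory ([middle_unit_completely_simple]): when e is an
    idempotent middle unit and every e · a has a right inverse relative to e,
    the monoid eSe is a group. An ideal meets eSe, so it contains e, hence all
    products s · e · t = s · t, that is, everything. The unit of a group is its
    only idempotent, so e is primitive; and a subgroup containing eSe has unit
    e, so it lies in eSe. *)

Section MiddleUnit.
Variables (S : Type) (op : S -> S -> S) (e : S).
Hypothesis opA : associative op.
Hypothesis ee : op e e = e.
Hypothesis middle : forall x y, op (op x e) y = op x y.
Hypothesis rinv : forall a, exists b, op (op e a) b = e.

Let eSe := [set op (op e b) e | b in [set: S]].

Lemma corner_unit x : eSe x -> op e x = x /\ op x e = x.
Proof. by case=> b _ <-; split; [rewrite !opA ee | rewrite -opA ee]. Qed.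

Lemma corner_mem x : op e x = x -> op x e = x -> eSe x.
Proof. by move=> ex xe; exists x => //; rewrite ex xe. Qed.

Lemma corner_rinv x : eSe x -> exists2 y, eSe y & op x y = e.
Proof.
move=> /corner_unit[ex xe]; have [b] := rinv x; rewrite ex => xb.
exists (op (op e b) e); first by exists b.
by rewrite !opA xe xb ee.
Qed.

Lemma corner_subgroup : semigroup_subgroup op eSe.
Proof.
split.
  move=> x y /corner_unit[ex xe] /corner_unit[ey ye].
  by apply: corner_mem; rewrite ?opA ?ex // -opA ye.
exists e; split; first by exists e => //; rewrite !ee.
  exact: corner_unit.
move=> x Gx; have [y Gy xy] := corner_rinv Gx; exists y; split=> //.
(* The right inverse z of y agrees with x, so y is also a left inverse. *)
have [z _ yz] := corner_rinv Gy.
have [_ xe] := corner_unit Gx.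
have -> : op y x = op y (op (op x y) z) by rewrite -opA yz xe.
by rewrite xy opA middle.
Qed.

Lemma subgroup_idempotent (G : set S) x :
  semigroup_subgroup op G -> G x -> idempotent_elt op x ->
  forall y, G y -> op x y = y /\ op y x = y.
Proof.
move=> [_ [u [Gu unitP invP]]] Gx xx.
suff -> : x = u by [].
have [y [Gy xy _]] := invP _ Gx; have [_ xu] := unitP _ Gx.
by rewrite -xy -{2}xx -opA xy xu.
Qed.

Lemma middle_unit_maximal_subgroup : maximal_subgroup op eSe.
Proof.
split; first exact: corner_subgroup.
move=> H HG sub; apply/seteqP; split=> // h Hh.
have He : H e by apply: sub; exists e => //; rewrite !ee.
by have [eh he] := subgroup_idempotent HG He ee Hh; apply: corner_mem.
Qed.

Lemma middle_unit_primitive : primitive_idempotent op e.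
Proof.
split=> // f ff ef fe.
have Gf := corner_mem ef fe.
have Ge : eSe e by exists e => //; rewrite !ee.
have [<- _] := subgroup_idempotent corner_subgroup Gf ff Ge.
by rewrite fe.
Qed.

Lemma middle_unit_simple :
  (forall x, exists y z, x = op y z) -> simple_semigroup op.
Proof.
move=> factor; split=> // I [[x Ix] idealI]; apply/seteqP; split=> // w _.
have Ie : I e.
  have [b <-] := rinv x.
  by apply: (proj2 (idealI _ _ _)); apply: (proj1 (idealI _ _ Ix)).
have [y [z ->]] := factor w; rewrite -middle.
by apply: (proj2 (idealI _ _ _)); apply: (proj1 (idealI _ _ Ie)).
Qed.

Lemma middle_unit_completely_simple :
  (forall x, exists y z, x = op y z) ->
  completely_simple op /\ maximal_subgroup op eSe.
Proof.
move=> factor; split; last exact: middle_unit_maximal_subgroup.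
split; first exact: middle_unit_simple.
by exists e; apply: middle_unit_primitive.
Qed.

End MiddleUnit.

(** Two powers of each element y of A coincide, so y^-1 is a power of y. *)
Lemma finite_submonoid_group_closed (G : groupType) (A : set G) :
  finite_set A -> monoid_closed (mem A) -> group_closed (mem A).
Proof.
move=> finA [A1 AM]; split=> // x y Ax Ay; apply: (AM) => //.
have Aexp n : y ^+ n \in mem A.
  by elim: n => [|n IH]; rewrite ?expg0 // expgS; apply: AM.
have [m [n [lt_mn exp_eq]]] : exists m n, (m < n)%N /\ y ^+ m = y ^+ n.
  apply: contrapT => noeq; apply: infinite_nat.
  have -> : [set: nat] = (fun n => y ^+ n) @^-1` A.
    by apply/seteqP; split=> // n _; exact: set_mem (Aexp n).
  apply: finite_preimage => // m n _ _ exp_eq.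
  by case: (ltngtP m n) => // lt; case: noeq; [exists m, n | exists n, m].
suff -> : y^-1 = y ^+ (n - m.+1) by [].
by rewrite expgnFr // -exp_eq expgS invgM mulVKg.
Qed.

Section SemiBrace.
Variable B : leftSemiBraceType.
Implicit Types a b c x : B.

Definition lambda a c : B := a ∘ (a^-1 · c).

Lemma circ_dotE a b c : a ∘ (b · c) = (a ∘ b) · lambda a c.
Proof. exact: circ_dot. Qed.

Lemma lambda1 c : lambda 1 c = 1 · c.
Proof. by rewrite /lambda invg1 mul1g. Qed.

Lemma dot1_middle b c : b · 1 · c = b · c.
Proof. by rewrite -dotA -lambda1 -[b in LHS]mul1g -circ_dotE mul1g. Qed.

Lemma dot1_lambda a c : 1 · lambda a c = lambda a c.
Proof. by rewrite -(mulgV a) -circ_dotE. Qed.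

(** For u = 1 · 1, which is idempotent, expanding u^-1 ∘ (u · u) gives
    1 = 1 · λ_(u^-1)(u) = λ_(u^-1)(u), so that 1 is fixed by left multiplication by 1. *)
Lemma dot11 : 1 · 1 = 1 :> B.
Proof.
set u : B := 1 · 1.
have uu : u · u = u by rewrite /u dotA !dot1_middle.
have eq1 : 1 = lambda u^-1 u.
  have := circ_dotE u^-1 u u.
  by rewrite uu mulVg dot1_lambda.
by rewrite /u {2}eq1 dot1_lambda -eq1.
Qed.

Lemma dot_factor x : exists y z, x = y · z.
Proof.
by exists x, (lambda x 1); have := circ_dotE x 1 1; rewrite dot11 !mulg1.
Qed.

Lemma circ_left_translate a b : a ∘ (1 · b) = a · lambda a b.
Proof. by rewrite circ_dotE mulg1. Qed.

Let leftB := [set (1 : B) · b | b in [set: B]].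

Lemma left_translateP x : leftB x <-> 1 · x = x.
Proof.
split=> [[b _ <-]|<-]; last by exists x.
by rewrite dotA dot11.
Qed.

Lemma left_translate_submonoid : monoid_closed (mem leftB).
Proof.
split; first by apply/mem_set/left_translateP/dot11.
move=> x y /set_mem/left_translateP x1 /set_mem/left_translateP y1.
apply/mem_set/left_translateP.
by rewrite -y1 circ_left_translate dotA x1.
Qed.

(** For a in 1B, take b = a^-1, which is again in 1B, in a · λ_a(b) = a ∘ b. *)
Lemma left_translate_rinv a :
  group_closed (mem leftB) -> exists b, 1 · a · b = 1.
Proof.
move=> /group_closedV inv; exists (lambda (1 · a) (1 · a)^-1).
have /inv/set_mem/left_translateP aV : 1 · a \in mem leftB.
  by apply: mem_set; exists a.
by rewrite -circ_left_translate aV mulgV.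
Qed.

End SemiBrace.

Theorem theorem2p8 (B : leftSemiBraceType) :
  (finite_set [set: B] ->
     group_closed (mem [set (1 : B) · b | b in [set: B]])) /\
  (group_closed (mem [set (1 : B) · b | b in [set: B]]) ->
     completely_simple (@dot B) /\
     maximal_subgroup (@dot B) [set (1 : B) · b · 1 | b in [set: B]]).
Proof.
split=> [finB|subgroup1B].
  apply: finite_submonoid_group_closed; last exact: left_translate_submonoid.
  by apply: sub_finite_set finB.
apply: middle_unit_completely_simple.
- exact: dotA.
- exact: dot11.
- exact: dot1_middle.
- by move=> a; apply: left_translate_rinv.
- exact: dot_factor.
Qed.
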